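(* Let $G$ be a finite simple graph on $n$ vertices with $\alpha(G)\le 2$ that contains no induced subgraph isomorphic to the one-wall-house graph. Then $G$ contains $K_{\lceil n/2\rceil}$ as an immersion.
   Context: $\alpha(G)$ is the independence number. The one-wall-house graph is the 5-vertex graph with vertices $a,b,c,d,e$ and edges $ab, be, ea, ad, dc$ (a triangle $a,b,e$ with a path $a,d,c$ of length two attached at $a$; i.e. the house graph with one wall edge removed). A graph $G$ contains a graph $K$ as an immersion if there is an injective map $\phi\colon V(K)\to V(G)$ such that for every edge $uv\in E(K)$ there is a path $P_{uv}$ in $G$ with endpoints $\phi(u),\phi(v)$, the paths $P_{uv}$ are pairwise edge-disjoint, and no vertex of $\phi(V(K))$ is an interior vertex of any path $P_{uv}$. *)

(* Defs.v *)
From mathcomp Require Import all_boot.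

Set Implicit Arguments.
Unset Strict Implicit.
Unset Printing Implicit Defensive.

Record sgraph := SGraph {
  vertex :> finType;
  adj : rel vertex;
  adj_sym : symmetric adj;
  adj_irrefl : irreflexive adj
}.

Definition edges (G : sgraph) : {set {set G}} :=
  [set [set p.1; p.2] | p in [set p : G * G | adj p.1 p.2]].

Definition independent (G : sgraph) (A : {set G}) : bool :=
  [forall x in A, forall y in A, ~~ adj x y].

Definition alpha (G : sgraph) : nat :=
  \max_(A : {set G} | independent A) #|A|.

Definition complete_rel (m : nat) : rel 'I_m := fun i j => i != j.

Fact complete_sym m : symmetric (@complete_rel m).
Proof. by move=> i j; rewrite /complete_rel eq_sym. Qed.

Fact complete_irrefl m : irreflexive (@complete_rel m).
Proof. by move=> i; rewrite /complete_rel eqxx. Qed.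

Definition complete_graph (m : nat) : sgraph :=
  SGraph (@complete_sym m) (@complete_irrefl m).

(* The vertices a, b, c, d, e are 0, 1, 2, 3, 4; the edges listed are
   ab, be, ea, ad, dc. *)
Definition one_wall_house_edges : seq (nat * nat) :=
  [:: (0, 1); (1, 4); (4, 0); (0, 3); (3, 2)].

Definition one_wall_house_rel : rel 'I_5 := fun u v =>
  ((val u, val v) \in one_wall_house_edges)
  || ((val v, val u) \in one_wall_house_edges).

Fact one_wall_house_sym : symmetric one_wall_house_rel.
Proof. by move=> u v; rewrite /one_wall_house_rel orbC. Qed.

Fact one_wall_house_irrefl : irreflexive one_wall_house_rel.
Proof. by case=> [[|[|[|[|[|n]]]]] i]. Qed.

Definition one_wall_house : sgraph :=
  SGraph one_wall_house_sym one_wall_house_irrefl.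

Definition induced_rel (G : sgraph) (A : {set G}) : rel {x : G | x \in A} :=
  fun x y => adj (val x) (val y).

Fact induced_sym (G : sgraph) (A : {set G}) : symmetric (@induced_rel G A).
Proof. by move=> x y; apply: adj_sym. Qed.

Fact induced_irrefl (G : sgraph) (A : {set G}) :
  irreflexive (@induced_rel G A).
Proof. by move=> x; apply: adj_irrefl. Qed.

Definition induced (G : sgraph) (A : {set G}) : sgraph :=
  SGraph (@induced_sym G A) (@induced_irrefl G A).

Definition isomorphic (G H : sgraph) : Prop :=
  exists2 f : G -> H, bijective f & forall x y, adj (f x) (f y) = adj x y.

Definition contains_induced (G H : sgraph) : Prop :=
  exists A : {set G}, isomorphic (induced A) H.

(* A path of G is represented by its nonempty sequence of vertices, without
   repetition; it is read up to reversal through its ends, edges and interior,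
   which are all unordered. *)
Definition is_path (G : sgraph) (s : seq G) : bool :=
  [&& s != [::], sorted (@adj G) s & uniq s].

Definition path_ends (G : sgraph) (s : seq G) : {set G} :=
  if s is x :: p then [set x; last x p] else set0.

Definition path_edges (G : sgraph) (s : seq G) : {set {set G}} :=
  if s is x :: p
  then [set:: pairmap (fun y z : G => [set y; z]) x p] else set0.

Definition path_interior (G : sgraph) (s : seq G) : {set G} :=
  [set:: s] :\: path_ends s.

(* The path assigned to the edge E = {u, v} of K is P E; its set of endpoints
   is the image phi @: E = {phi u, phi v}. *)
Definition contains_immersion (G K : sgraph) : Prop :=
  exists (phi : K -> G) (P : {set K} -> seq G),
    [/\ injective phi,
        forall E, E \in edges K ->
          is_path (P E) /\ path_ends (P E) = phi @: E,
        forall E F, E \in edges K -> F \in edges K -> E != F ->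
          [disjoint path_edges (P E) & path_edges (P F)]
      & forall E w, E \in edges K -> phi w \notin path_interior (P E)].

(* Main.v *)
(** Work in the complement [h] of [G], which is triangle-free and contains no
    induced 4-cycle with a pendant edge. Every immersion built here uses paths
    of length at most two: a set [B] of branch vertices together with, for each
    pair [x, y] of [B] that is [h]-adjacent, a middle vertex outside [B], the
    middle vertices of two pairs sharing an end being distinct.

    If [h] has a 4-cycle, the forbidden subgraph forces its component to be
    complete bipartite; the larger side is a clique of [G] containing at least
    half of the component, and the component can be split off because [G] is a
    join. If [h] has no 4-cycle, then for an [h]-edge [xy] the other neighbours
    of [x] and [y] form an independent set [I] of [h], i.e. a clique of [G]. If
    [I] always has fewer than [floor (n/2)] elements, middle vertices can be
    chosen greedily for any [B] of size [ceil (n/2)]: an element of [I] in [B]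
    forbids one colour by conflict, an element outside [B] forbids itself.
    Otherwise [I] is a large enough clique, or misses one vertex [r], and the at
    most two [h]-edges from [r] to [I] are bridged by [x] and [y]. *)

Require Import Defs.
From mathcomp Require Import all_boot zify.

Set Implicit Arguments.
Unset Strict Implicit.
Unset Printing Implicit Defensive.

Lemma set2_inj (T : finType) (a b c d : T) :
  [set a; b] = [set c; d] -> (a = c /\ b = d) \/ (a = d /\ b = c).
Proof.
move=> /setP E.
have := E a; have := E b; have := E c; have := E d.
rewrite !inE !eqxx !orbT /=.
by do ![case: eqVneq => [?|?] //=; subst] => *; subst; auto.
Qed.

(** * Greedy list colouring *)

(** Colour all but one element by induction: the elements conflicting with the last one use fewer
    colours than its list holds, so a colour remains. [c0] supplies a value when [E] is empty. *)
Lemma greedy_colouring (T C : finType) (c0 : C) (conflict : rel T)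
    (L : T -> {set C}) (E : {set T}) :
  symmetric conflict ->
  (forall e, e \in E ->
     #|[set e' in E | (e' != e) && conflict e e']| < #|L e|) ->
  exists f : T -> C,
    (forall e, e \in E -> f e \in L e) /\
    (forall e e', e \in E -> e' \in E -> e' != e -> conflict e e' ->
       f e != f e').
Proof.
move=> csym; move: {2}#|E| (erefl #|E|) => n; elim: n E => [|n IH] E cardE lt.
  by exists (fun=> c0); split=> e; rewrite (cards0_eq cardE) inE.
have [E0|[e eE]] := set_0Vmem E; first by rewrite E0 cards0 in cardE.
have [|e' e'E|f [fL fc]] := IH (E :\ e).
- by have := cardsD1 e E; rewrite eE cardE => -[].
- apply: leq_ltn_trans (lt e' _); last by case/setD1P: e'E.
  apply/subset_leq_card/subsetP=> z; rewrite !inE.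
  by case/andP=> /andP[_ ->] ->.
set bad := f @: [set e' in E | (e' != e) && conflict e e'].
have [c cL cbad] : exists2 c, c \in L e & c \notin bad.
  apply/subsetPn/negP => /subset_leq_card; apply/negP; rewrite -ltnNge.
  exact: leq_ltn_trans (leq_imset_card _ _) (lt e eE).
have fbad z : z \in E -> z != e -> conflict e z -> f z != c.
  move=> zE ze cz; apply: contraNneq cbad => <-.
  by apply: imset_f; rewrite inE zE ze.
exists (fun z => if z == e then c else f z); split=> [z zE|y z yE zE].
  by case: eqVneq => [->//|ze]; apply: fL; rewrite !inE ze.
case: (eqVneq z e) => [->|ze]; case: (eqVneq y e) => [->|ye].
- by rewrite eqxx.
- by rewrite csym => _ /fbad; apply.
- by move=> _ /fbad fz; rewrite eq_sym; apply: fz.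
- by apply: fc; rewrite !inE ?ye ?ze.
Qed.

(** * Linked sets of branch vertices *)

(** The complement [h] of [G], kept as a relation on the vertices of [G]. *)
Definition nonadj (G : sgraph) : rel G := fun x y => (x != y) && ~~ adj x y.

Lemma nonadj_sym (G : sgraph) : symmetric (@nonadj G).
Proof. by move=> x y; rewrite /nonadj eq_sym adj_sym. Qed.

Lemma nonadj_irrefl (G : sgraph) : irreflexive (@nonadj G).
Proof. by move=> x; rewrite /nonadj eqxx. Qed.

Lemma adjE (G : sgraph) (x y : G) : adj x y = (x != y) && ~~ nonadj x y.
Proof.
by rewrite /nonadj; case: eqVneq => [->|_] /=; rewrite ?adj_irrefl ?negbK.
Qed.

(** [B] is the branch set and [w x y] the middle of the path replacing the missing edge [xy]. Two
    such paths with disjoint pairs of ends share no edge even through a common middle, so only pairs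
    with a common end are constrained. Middles stay in [S] so that disjoint sets can be linked
    independently. *)
Definition linkable (G : sgraph) (S : {set G}) (m : nat) : Prop :=
  exists (B : {set G}) (w : G -> G -> G),
    [/\ B \subset S, m <= #|B|,
        {in B &, forall x y, nonadj x y ->
           [/\ w x y = w y x, w x y \in S :\: B & adj x (w x y)]}
      & {in B & &, forall x y z, nonadj x y -> nonadj x z -> y != z ->
           w x y != w x z}].

Lemma linkable_clique (G : sgraph) (S B : {set G}) (m : nat) :
  B \subset S -> m <= #|B| -> {in B &, forall x y, ~~ nonadj x y} ->
  linkable S m.
Proof.
move=> BS mB cl; exists B, (fun x _ => x); split=> //.
  by move=> x y xB yB; rewrite (negPf (cl _ _ xB yB)).
by move=> x y z xB yB zB; rewrite (negPf (cl _ _ xB yB)).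
Qed.

(** A missing edge inside [B1 :|: B2] lies within one side, and its middle stays in that side, hence
    off the other branch set. *)
Lemma linkable_join (G : sgraph) (S1 S2 : {set G}) (m1 m2 : nat) :
  [disjoint S1 & S2] -> {in S1 & S2, forall x y, ~~ nonadj x y} ->
  linkable S1 m1 -> linkable S2 m2 -> linkable (S1 :|: S2) (m1 + m2).
Proof.
move=> dS join [B1 [w1 [sB1 mB1 w1P w1I]]] [B2 [w2 [sB2 mB2 w2P w2I]]].
have in1 x : x \in B1 -> x \in S1 by move/subsetP: sB1; apply.
have in2 x : x \in B2 -> x \in S2 by move/subsetP: sB2; apply.
have n12 x : x \in S1 -> (x \in S2) = false.
  by move=> xS1; rewrite (disjointFr dS).
have n21 x : x \in S2 -> (x \in S1) = false.
  by move=> xS2; rewrite (disjointFl dS).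
have same x y : x \in B1 :|: B2 -> y \in B1 :|: B2 -> nonadj x y ->
    (x \in B1) && (y \in B1) || (x \in B2) && (y \in B2).
  rewrite !inE => /orP[] xB /orP[] yB nxy; rewrite xB yB ?orbT //.
    by rewrite (negPf (join _ _ (in1 _ xB) (in2 _ yB))) in nxy.
  by rewrite nonadj_sym (negPf (join _ _ (in1 _ yB) (in2 _ xB))) in nxy.
exists (B1 :|: B2), (fun x y => if x \in S1 then w1 x y else w2 x y); split.
- exact: setUSS.
- have -> : #|B1 :|: B2| = #|B1| + #|B2|.
    apply/eqP; rewrite (leq_card_setU B1 B2).2.
    exact: disjointWl sB1 (disjointWr sB2 dS).
  exact: leq_add.
- move=> x y xB yB nxy.
  case/orP: (same x y xB yB nxy) => /andP[{}xB {}yB].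
    rewrite !in1 //; have [-> wS ax] := w1P _ _ xB yB nxy; split=> //.
    move: wS; rewrite !inE => /andP[/negPf-> wS]; rewrite wS /= andbT.
    by apply: contraFN (n12 _ wS) => /in2.
  rewrite !n21 ?in2 //; have [-> wS ax] := w2P _ _ xB yB nxy; split=> //.
  move: wS; rewrite !inE => /andP[/negPf-> wS]; rewrite wS orbT orbF andbT.
  by apply: contraFN (n21 _ wS) => /in1.
- move=> x y z xB yB zB nxy nxz yz.
  have := same x y xB yB nxy; have := same x z xB zB nxz.
  case/orP=> /andP[{}xB {}zB]; case/orP=> /andP[x'B {}yB].
  + by rewrite in1 //; apply: w1I.
  + by have := n12 _ (in1 _ xB); rewrite in2.
  + by have := n21 _ (in2 _ xB); rewrite in1.
  + by rewrite n21 ?in2 //; apply: w2I.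
Qed.

Lemma immersion_of_linkable (G : sgraph) (m : nat) :
  linkable [set: G] m -> contains_immersion G (complete_graph m).
Proof.
move=> [B [w [_ mB wP wI]]].
pose phi (i : complete_graph m) : G := enum_val (widen_ord mB i).
have phiB i : phi i \in B by apply: enum_valP.
have phi_inj : injective phi.
  by move=> i j /enum_val_inj /(congr1 val) /= /val_inj.
pose link (x y : G) : seq G := if adj x y then [:: x; y] else [:: x; w x y; y].
(* An edge of the complete graph is an unordered set, so [pick] orders its ends; either order serves
   because [w] is symmetric. *)
pose P (E : {set complete_graph m}) : seq G :=
  if [pick p : complete_graph m * complete_graph m |
        (E == [set p.1; p.2]) && (p.1 != p.2)] is Some p
  then link (phi p.1) (phi p.2) else [::].
have PE E : E \in edges (complete_graph m) ->
    exists i j, [/\ i != j, E = [set i; j] & P E = link (phi i) (phi j)].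
  move=> /imsetP[[i j]]; rewrite inE /= => ij ->; rewrite /P.
  case: pickP => [[k l] /andP[/= /eqP Ekl kl]|/(_ (i, j))].
    by exists k, l.
  by rewrite /= eqxx /= (ij : i != j).
have linkN i j : i != j -> ~~ adj (phi i) (phi j) ->
    nonadj (phi i) (phi j).
  by move=> ij na; rewrite /nonadj na (inj_eq phi_inj) ij.
have notB (w' : G) i : w' \in [set: G] :\: B -> (w' == phi i) = false.
  by rewrite inE => /andP[w'B _]; apply: contraNF w'B => /eqP->.
(* The pair is oriented so that [e] leaves [phi i]; for the second half of a two-edge path this uses
   the symmetry of [w]. *)
have edgeE E e : E \in edges (complete_graph m) -> e \in path_edges (P E) ->
    exists i j, [/\ i != j, E = [set i; j] &
      e = [set phi i; phi j] \/
      nonadj (phi i) (phi j) /\ e = [set phi i; w (phi i) (phi j)]].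
  move=> /PE[i [j [ij -> ->]]]; rewrite /link; case: ifPn => [_|na] /=.
    by rewrite !inE => /eqP->; exists i, j; split=> //; left.
  have nij := linkN _ _ ij na.
  rewrite !inE => /orP[] /eqP->.
    by exists i, j; split=> //; right.
  exists j, i; split; rewrite 1?eq_sym // 1?setUC //; right.
  rewrite nonadj_sym; split=> //.
  by have [-> _ _] := wP _ _ (phiB i) (phiB j) nij; rewrite setUC.
exists phi, P; split=> //.
- move=> E /PE[i [j [ij -> ->]]]; rewrite imsetU1 imset_set1 /link.
  have pij : phi i != phi j by rewrite (inj_eq phi_inj).
  case: ifPn => [a|na].
    by rewrite /is_path /= a inE pij.
  have nij := linkN _ _ ij na.
  have [wC wB aw] := wP _ _ (phiB i) (phiB j) nij.
  have [|_ _ aw'] := wP _ _ (phiB j) (phiB i); first by rewrite nonadj_sym.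
  rewrite /is_path /= aw adj_sym wC aw' !inE (negPf pij) -wC notB //.
  by rewrite eq_sym notB.
- move=> E F EK FK EF; rewrite -setI_eq0; apply/eqP/setP=> e.
  rewrite [RHS]inE; apply/negP; rewrite inE => /andP[].
  move=> /(edgeE _ _ EK)[i [j [ij EE eE]]] /(edgeE _ _ FK)[k [l [kl FE eF]]].
  have wB x y : nonadj (phi x) (phi y) -> w (phi x) (phi y) \notin B.
    by move=> n; have [_ /setDP[_]] := wP _ _ (phiB x) (phiB y) n.
  (* Middles are not branch vertices, so a one-edge path shares no edge with a two-edge path. Two
     two-edge paths sharing an edge have a common end and the same middle, which [wI] excludes. *)
  case: eF => [|[nkl]] eF; case: eE => [|[nij]] eE; rewrite eE in eF.
  + case: (set2_inj eF) => -[/phi_inj ik /phi_inj jl]; case/eqP: EF;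
      by rewrite EE FE ik jl // setUC.
  + by case: (set2_inj eF) => -[_ wE]; have := wB _ _ nij; rewrite wE phiB.
  + by case: (set2_inj eF) => [[_ wE]|[wE _]]; have := wB _ _ nkl;
      rewrite -wE phiB.
  + case: (set2_inj eF) => -[ik wE].
      have {}ik := phi_inj _ _ ik; subst k.
      have [jl|jl] := eqVneq j l; first by case/eqP: EF; rewrite EE FE jl.
      have := wI _ _ _ (phiB i) (phiB j) (phiB l) nij nkl.
      by rewrite (inj_eq phi_inj) jl wE eqxx => /(_ isT).
    by have := wB _ _ nkl; rewrite -ik phiB.
- move=> E k /PE[i [j [ij _ ->]]]; rewrite /path_interior /link.
  case: ifPn => [_|na]; rewrite !inE.
    by case: eqVneq => //= _; case: eqVneq.
  have [_ wB _] := wP _ _ (phiB i) (phiB j) (linkN _ _ ij na).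
  rewrite (eq_sym (phi k) (w (phi i) (phi j))) (notB _ _ wB) /=.
  by case: eqVneq => //= _; case: eqVneq.
Qed.

(** * Complements of triangle-free graphs without 4-cycles *)

Definition triangle_free (T : Type) (h : rel T) : Prop :=
  forall x y z, h x y -> h y z -> ~~ h x z.

Lemma nonadj_triangle_free (G : sgraph) :
  alpha G <= 2 -> triangle_free (@nonadj G).
Proof.
move=> a2 x y z hxy hyz; apply: contraL a2 => hxz; rewrite -ltnNge.
have nE (u v : G) : nonadj u v -> (adj u v = false) * (adj v u = false) * (u == v = false).
  by rewrite (adj_sym v) /nonadj => /andP[/negPf-> /negPf->].
have -> : 3 = #|[set x; y; z]|.
  by rewrite -setUA !cardsU1 cards1 !inE !(nE _ _ hxy, nE _ _ hyz, nE _ _ hxz).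
apply: (@leq_bigmax_cond _ (@independent G) (fun A : {set G} => #|A|)).
apply/forall_inP=> u uA; apply/forall_inP=> v; move: uA.
rewrite !inE -!orbA => /or3P[] /eqP-> /or3P[] /eqP->;
  by rewrite ?adj_irrefl ?(nE _ _ hxy) ?(nE _ _ hyz) ?(nE _ _ hxz).
Qed.

(** These vertices play two roles for the pair [xy]: outside the branch set they are the unusable
    middles, inside it they are the far ends of the conflicting pairs. *)
Definition link_nbrs (G : sgraph) (S : {set G}) (x y : G) : {set G} :=
  [set z in S | (nonadj x z && (z != y)) || (nonadj y z && (z != x))].

Lemma linkable_greedy (G : sgraph) (S : {set G}) :
  triangle_free (@nonadj G) ->
  {in S &, forall x y, nonadj x y -> #|link_nbrs S x y| < #|S|./2} ->
  linkable S (uphalf #|S|).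
Proof.
move=> tf small.
(* The colouring needs a default vertex [s0], so the empty set is treated apart. *)
have [S0|[s0 _]] := set_0Vmem S.
  by apply: (@linkable_clique _ _ set0); rewrite ?sub0set ?S0 ?cards0 // => x y; rewrite inE.
have [B BS cardB] : exists2 B : {set G}, B \subset S & #|B| = uphalf #|S|.
  exists [set x in take (uphalf #|S|) (enum S)].
    by apply/subsetP=> x; rewrite inE => /mem_take; rewrite mem_enum.
  rewrite cardsE (card_uniqP (take_uniq _ (enum_uniq _))) size_take -cardE.
  by case: ltnP => // ?; lia.
have cardW : #|S :\: B| = #|S|./2.
  by rewrite cardsD (setIidPr BS) cardB; lia.
pose E := [set e : {set G} | [exists x in B, exists y in B,
  nonadj x y && (e == [set x; y])]].
pose conflict (e e' : {set G}) := e :&: e' != set0.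
pose L (e : {set G}) := [set c in S :\: B | [forall z in e, adj z c]].
have inS x : x \in B -> x \in S by move/subsetP: BS; apply.
have EP e : reflect (exists x y, [/\ x \in B, y \in B, nonadj x y & e = [set x; y]]) (e \in E).
  rewrite inE; apply: (iffP exists_inP) => [[x xB /exists_inP[y yB /andP[n /eqP->]]]|].
    by exists x, y.
  move=> [x [y [xB yB n ->]]]; exists x => //; apply/exists_inP; exists y => //.
  by rewrite n eqxx.
have [|e /EP[x [y [xB yB nxy ->]]]|f [fL fc]] :=
  @greedy_colouring _ _ s0 conflict L E.
- by move=> e e'; rewrite /conflict setIC.
- have := small _ _ (inS _ xB) (inS _ yB) nxy; rewrite -cardW.
  set I := link_nbrs S x y => ltI.
  have leL : #|(S :\: B) :\: I| <= #|L [set x; y]|.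
    apply/subset_leq_card/subsetP=> c /setDP[cW cI].
    rewrite inE cW /=; case/setDP: (cW) => cS cB.
    have cx : c != x by apply: contraNneq cB => ->.
    have cy : c != y by apply: contraNneq cB => ->.
    move: cI; rewrite inE cS cx cy !andbT negb_or => /andP[nx ny].
    apply/forall_inP=> z; rewrite !inE => /orP[] /eqP->.
      by rewrite adjE eq_sym cx.
    by rewrite adjE eq_sym cy.
  (* [g] sends [z] to the missing edge joining it to [x] or [y]; its image on [I :&: B] covers all
     pairs in conflict with [xy]. *)
  pose g z := if nonadj x z then [set x; z] else [set y; z].
  have leC : #|[set e' in E | (e' != [set x; y]) && conflict [set x; y] e']|
      <= #|I :&: B|.
    apply: leq_trans (leq_imset_card g _).
    apply/subset_leq_card/subsetP=> e'; rewrite inE => /andP[/EP[u [v [uB vB nuv ->]]]].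
    have main u' v' : u' \in [set x; y] -> v' \in B -> nonadj u' v' ->
        [set u'; v'] != [set x; y] -> [set u'; v'] \in g @: (I :&: B).
      move=> /set2P[]-> v'B n ne.
        have v'y : v' != y by apply: contraNneq ne => ->.
        apply/imsetP; exists v'; last by rewrite /g n.
        by rewrite in_setI v'B andbT inE inS // n v'y.
      have v'x : v' != x by apply: contraNneq ne => ->; rewrite setUC.
      have nx := tf _ _ _ nxy n.
      apply/imsetP; exists v'; last by rewrite /g (negPf nx).
      by rewrite in_setI v'B andbT inE inS // n v'x orbT.
    case/andP=> ne /set0Pn[t]; rewrite inE => /andP[txy].
    rewrite [t \in _]inE !inE => /orP[] /eqP tE; subst t; first exact: main.
    by rewrite setUC; apply: main; rewrite 1?nonadj_sym // setUC.
  (* The list has at least [#|S :\: B| - #|I :\: B|] colours, which exceeds [#|I :&: B|] because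
     [#|I| < #|S :\: B|]. *)
  have := cardsID B I; have := cardsID I (S :\: B).
  have : #|(S :\: B) :&: I| <= #|I :\: B|.
    by apply/subset_leq_card/subsetP=> z; rewrite !inE => /andP[/andP[-> _] ->].
  lia.
have fE x y : x \in B -> y \in B -> nonadj x y -> f [set x; y] \in L [set x; y].
  by move=> xB yB n; apply/fL/EP; exists x, y.
exists B, (fun x y => f [set x; y]); split=> //; first by rewrite cardB.
  move=> x y xB yB n; split; first by rewrite setUC.
    by have := fE _ _ xB yB n; rewrite inE => /andP[].
  have := fE _ _ xB yB n; rewrite inE => /andP[_ /forall_inP]; apply.
  by rewrite !inE eqxx.
move=> x y z xB yB zB nxy nxz yz; apply: fc.
- by apply/EP; exists x, y.
- by apply/EP; exists x, z.
- apply: contraNneq yz => /set2_inj[[_ ->]//|[xy zx]].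
  by rewrite -xy nonadj_irrefl in nxy.
- by apply/set0Pn; exists x; rewrite !inE eqxx.
Qed.

Definition C4_free (T : finType) (h : rel T) (S : {set T}) : Prop :=
  forall b c e d, b \in S -> c \in S -> e \in S -> d \in S ->
    h b c -> h c e -> h e d -> h d b -> (b == e) || (c == d).

Lemma linkable_C4_free (G : sgraph) (S : {set G}) :
  triangle_free (@nonadj G) -> C4_free (@nonadj G) S ->
  linkable S (uphalf #|S|).
Proof.
move=> tf c4.
have [/existsP[[x y] /= /and4P[xS yS nxy big]]|small] := boolP [exists p : G * G,
  [&& p.1 \in S, p.2 \in S, nonadj p.1 p.2 & #|S|./2 <= #|link_nbrs S p.1 p.2|]];
  last first.
  apply: linkable_greedy => // x y xS yS nxy; rewrite ltnNge.
  by apply: contra small => le; apply/existsP; exists (x, y); rewrite /= xS yS nxy.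
set I := link_nbrs S x y in big.
have leI : uphalf #|S| <= #|I|.+1 by lia.
have IE z : (z \in I) =
    (z \in S) && (nonadj x z && (z != y) || nonadj y z && (z != x)).
  by rewrite inE.
clearbody I.
have IS : I \subset S by apply/subsetP=> z; rewrite IE => /andP[].
have nC := @nonadj_sym G.
(* An [h]-edge inside [I] closes a triangle if its ends have the same neighbour among [x] and [y],
   and a 4-cycle through [xy] otherwise. *)
have cI : {in I &, forall u v, ~~ nonadj u v}.
  move=> u v; rewrite !IE => /andP[uS hu] /andP[vS hv]; apply/negP => nuv.
  case/orP: hu => /andP[nu une]; case/orP: hv => /andP[nv vne].
  - by have := tf _ _ _ nu nuv; rewrite nv.
  - have := c4 x u v y xS uS vS yS nu nuv; rewrite !(nC _ y) nv nC.
    by rewrite nxy (negPf une) eq_sym (negPf vne) => /(_ isT isT).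
  - have := c4 y u v x yS uS vS xS nu nuv; rewrite (nC v) nv.
    by rewrite nxy (negPf une) eq_sym (negPf vne) => /(_ isT isT).
  - by have := tf _ _ _ nu nuv; rewrite nv.
have [le|lt] := leqP (uphalf #|S|) #|I|; first exact: linkable_clique IS le cI.
have xI : x \notin I by rewrite IE nonadj_irrefl eqxx /= !andbF.
have yI : y \notin I by rewrite IE nonadj_irrefl eqxx /= !andbF.
have xy : x != y by case/andP: nxy.
have [R0|[r]] := set_0Vmem (S :\: (x |: (y |: I))).
  (* With no vertex left for [r], the bounds force [#|I| = 1] and [#|S| = 3]. The single [p] of [I]
     is [h]-adjacent to only one of [x] and [y], so it forms a clique of [G] with the other. *)
  have cardS : #|S| = #|I| + 2.
    have -> : S = x |: (y |: I).
      apply/eqP; rewrite eqEsubset -setD_eq0 R0 eqxx !subUset !sub1set xS yS.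
      by rewrite IS.
    by rewrite !cardsU1 !inE (negPf xy) (negPf xI) (negPf yI); lia.
  have [/cards0_eq I0|/card_gt0P[p pI]] := posnP #|I|.
    by rewrite I0 cards0 in lt big; lia.
  have pS : p \in S by apply: (subsetP IS).
  have cardI : uphalf #|S| = 2 by clear -cardS big lt; lia.
  have edge q : q \in S -> p != q -> ~~ nonadj p q -> linkable S (uphalf #|S|).
    move=> qS pq npq; apply: (@linkable_clique _ _ [set p; q]).
    - by rewrite subUset !sub1set pS.
    - by rewrite cards2 pq cardI.
    - by move=> u v /set2P[]-> /set2P[]->; rewrite ?nonadj_irrefl // nC.
  have := pI; rewrite IE pS /= => /orP[] /andP[np pne].
    by apply: (edge y) => //; apply: (tf _ x); rewrite // nC.
  by apply: (edge x) => //; apply: (tf _ y); rewrite // nC.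
rewrite !inE !negb_or => /andP[/and3P[rx ry rI] rS].
have [nxr nyr] : ~~ nonadj x r /\ ~~ nonadj y r.
  by move: rI; rewrite IE rS rx ry !andbT negb_or => /andP[].
(* [r] has at most one neighbour in each half of [I], so [w] only has to
   distinguish the two halves. *)
pose mid u := if nonadj x u then y else x.
pose w u v := if u == r then mid v else mid u.
(* Since [r] is outside [I], it is adjacent in [G] to both [x] and [y]; triangle-freeness makes [u]
   adjacent to the one chosen. *)
have midP u : u \in I -> [/\ mid u \in S :\: (r |: I), adj r (mid u) & adj u (mid u)].
  rewrite /mid => uI; have := uI; rewrite IE => /andP[uS].
  case: ifP => [nxu _|nxu /= /andP[nyu ux]].
    have uy : u != y by apply: contraNneq yI => <-.
    rewrite !inE (negPf yI) eq_sym (negPf ry) yS; split=> //.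
      by rewrite adjE ry nC.
    by rewrite adjE uy; apply: (tf _ x); rewrite // nC.
  rewrite !inE (negPf xI) eq_sym (negPf rx) xS; split=> //.
    by rewrite adjE rx nC.
  by rewrite adjE ux nC nxu.
have wr v : w r v = mid v by rewrite /w eqxx.
have wI u v : u \in I -> w u v = mid u.
  by rewrite /w; case: eqP => // -> rI'; rewrite rI' in rI.
exists (r |: I), w; split.
- by rewrite subUset sub1set rS.
- by rewrite cardsU1 rI.
- move=> u v /setU1P[->|uI] /setU1P[->|vI] nuv.
  + by rewrite nonadj_irrefl in nuv.
  + by have [? ? ?] := midP v vI; rewrite wr wI.
  + by have [? ? ?] := midP u uI; rewrite wr wI.
  + by rewrite (negPf (cI _ _ uI vI)) in nuv.
- move=> u v z /setU1P[->|uI] /setU1P[->|vI] /setU1P[->|zI] nuv nuz vz;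
    rewrite ?nonadj_irrefl ?eqxx // in nuv nuz vz.
  + rewrite !wr /mid.
    move: (vI) (zI); rewrite !IE => /andP[vS hv] /andP[zS hz].
    (* Two [h]-neighbours of [r] in the same half would form a 4-cycle with [r] and [x], or with [r]
       and [y]. *)
    case: ifPn hv => nxv hv; case: ifPn hz => nxz hz; rewrite ?xy // 1?eq_sym //.
    * have := c4 x v r z xS vS rS zS nxv.
      by rewrite nC nuv nuz nC nxz (negPf vz) eq_sym (negPf rx) => /(_ isT isT isT).
    * move: hv hz => /= /andP[nyv _] /andP[nyz _].
      have := c4 y v r z yS vS rS zS nyv.
      by rewrite nC nuv nuz nC nyz (negPf vz) eq_sym (negPf ry) => /(_ isT isT isT).
  + by rewrite (negPf (cI _ _ uI zI)) in nuz.
  + by rewrite (negPf (cI _ _ uI vI)) in nuv.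
  + by rewrite (negPf (cI _ _ uI vI)) in nuv.
Qed.

(** * Splitting off complete bipartite components *)

Lemma contains_induced_embedding (G H : sgraph) (g : H -> G) :
  injective g -> (forall i j, adj (g i) (g j) = adj i j) ->
  contains_induced G H.
Proof.
move=> g_inj g_adj; exists (g @: setT).
have gA i : g i \in g @: setT by apply: imset_f; rewrite inE.
pose g' i : induced (g @: setT) := exist _ (g i) (gA i).
have [||f g'K fK] := @inj_card_bij _ _ g'.
- by move=> i j /(congr1 val) /g_inj.
- by rewrite card_sig; have := card_imset setT g_inj; rewrite cardsT => <-.
exists f; first by exists g'.
by move=> x y; rewrite -{2}(fK x) -{2}(fK y) -g_adj.
Qed.

(** The banner is a 4-cycle with a pendant edge. In a triangle-free graph, a neighbour of one vertex
    of a 4-cycle that misses the opposite vertex induces it. *)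
Definition banner_free (T : eqType) (h : rel T) : Prop :=
  forall b c e d v, h b c -> h c e -> h e d -> h d b -> b != e -> c != d ->
    h v c -> h v d.

(* The complement of the one-wall-house is the cycle [b c e d] with the
   pendant edge [ac]. *)
Lemma nonadj_banner_free (G : sgraph) :
  triangle_free (@nonadj G) -> ~ contains_induced G one_wall_house ->
  banner_free (@nonadj G).
Proof.
move=> tf hf b c e d a bc ce ed db be cd ac; apply/negPn/negP => nad; apply: hf.
have nC := @nonadj_sym G.
have nab : ~~ nonadj a b by apply: (tf _ c); rewrite // nC.
have nae : ~~ nonadj a e by apply: (tf _ c).
have nbe : ~~ nonadj b e by apply: (tf _ c).
have ncd : ~~ nonadj c d by apply: (tf _ e).
have ab : a != b by apply: contraNneq nad => ->; rewrite nC.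
have ae : a != e by apply: contraNneq nad => ->.
have ad : a != d by apply: contraNneq ncd => <-; rewrite nC.
have nE (u v : G) : nonadj u v -> (adj u v = false) * (adj v u = false) * (u == v = false).
  by rewrite (adj_sym v) /nonadj => /andP[/negPf-> /negPf->].
have aE (u v : G) : u != v -> ~~ nonadj u v -> (adj u v = true) * (adj v u = true) * (u == v = false).
  by move=> uv n; rewrite (adj_sym v) adjE uv n (negPf uv).
have E := (nE _ _ bc, nE _ _ ce, nE _ _ ed, nE _ _ db, nE _ _ ac,
  (aE _ _ ab nab, aE _ _ ae nae, aE _ _ be nbe, aE _ _ cd ncd, aE _ _ ad nad)).
(* The order matches the numbering 0 to 4 of the vertices of [one_wall_house]. *)
pose s := [:: a; b; c; d; e].
have us : uniq s by rewrite /= !inE (eq_sym b d) (eq_sym d e) !E.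
apply: (@contains_induced_embedding G one_wall_house (fun i : 'I_5 => nth a s i)).
  by move=> i j /eqP; rewrite nth_uniq // => /eqP/val_inj.
by case=> [[|[|[|[|[|//]]]]] ?] [[|[|[|[|[|//]]]]] ?]; rewrite /= ?adj_irrefl ?E.
Qed.

Lemma linkable_half (G : sgraph) (S : {set G}) :
  triangle_free (@nonadj G) -> banner_free (@nonadj G) ->
  linkable S (uphalf #|S|).
Proof.
move=> tf bf; have [n] := ubnP #|S|; elim: n S => // n IH S /ltnSE ltS.
have nC := @nonadj_sym G.
have [/existsP[[[b c] [e d]] /= /andP[/and4P[bS cS eS dS]]]|no] :=
  boolP [exists p : G * G * (G * G),
  [&& p.1.1 \in S, p.1.2 \in S, p.2.1 \in S & p.2.2 \in S] &&
  [&& nonadj p.1.1 p.1.2, nonadj p.1.2 p.2.1, nonadj p.2.1 p.2.2,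
      nonadj p.2.2 p.1.1, p.1.1 != p.2.1 & p.1.2 != p.2.2]]; last first.
  apply: linkable_C4_free => // b c e d bS cS eS dS bc ce ed db.
  apply: contraR no; rewrite negb_or => /andP[be cd]; apply/existsP.
  by exists ((b, c), (e, d)); rewrite /= bS cS eS dS bc ce ed db be cd.
case/and5P=> bc ce ed db /andP[be cd].
pose X := [set x in S | nonadj x c]; pose Y := [set y in S | nonadj y b].
(* Any [x] in [X] other than [b] is [h]-adjacent to [d], so [c x d b] is again a 4-cycle and a
   neighbour of [x] is a neighbour of [b]. Hence no [h]-edge leaves [X :|: Y] within [S]. *)
have XY x v : x \in X -> v \in S -> nonadj v x -> v \in Y.
  rewrite !inE => /andP[xS xc] -> vx /=.
  have [xb|xb] := eqVneq x b; first by rewrite -xb.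
  have xd := bf _ _ _ _ _ bc ce ed db be cd xc.
  by apply: (bf c x d b v); rewrite // nC.
have YX y v : y \in Y -> v \in S -> nonadj v y -> v \in X.
  rewrite !inE => /andP[yS yb] -> vy /=.
  have [yc|yc] := eqVneq y c; first by rewrite -yc.
  have ye : nonadj y e by apply: (bf c b d e y); rewrite // nC.
  by apply: (bf b y e c v); rewrite // nC.
have cliqueX : {in X &, forall u v, ~~ nonadj u v}.
  by move=> u v; rewrite !inE => /andP[_ uc] /andP[_ vc]; apply: (tf _ c); rewrite // nC.
have cliqueY : {in Y &, forall u v, ~~ nonadj u v}.
  by move=> u v; rewrite !inE => /andP[_ uc] /andP[_ vc]; apply: (tf _ b); rewrite // nC.
have KS : X :|: Y \subset S.
  by apply/subsetP=> z; rewrite !inE => /orP[] /andP[].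
have linkK : linkable (X :|: Y) (uphalf #|X :|: Y|).
  have [leU _] := leq_card_setU X Y; rewrite /= in leU.
  have [le|lt] := leqP #|X| #|Y|.
    apply: (@linkable_clique _ _ Y); rewrite ?subsetUr //.
    by clear -leU le; lia.
  apply: (@linkable_clique _ _ X); rewrite ?subsetUl //.
  by clear -leU lt; lia.
have Kb : b \in X :|: Y by rewrite !inE bS bc.
have cardS : #|S| = #|X :|: Y| + #|S :\: (X :|: Y)|.
  by rewrite -(cardsID (X :|: Y) S) (setIidPr KS).
have Kpos : 0 < #|X :|: Y| by apply/card_gt0P; exists b.
have linkR : linkable (S :\: (X :|: Y)) (uphalf #|S :\: (X :|: Y)|).
  by apply: IH; clear -ltS cardS Kpos; lia.
have := linkable_join _ _ linkK linkR.
rewrite setDE setUIr setUCr setIT (setUidPr KS) => /(_ _ _)[].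
- by rewrite -setI_eq0 setIA setIAC setICr set0I.
- move=> u v uK /setIP[vS]; rewrite inE => vK; apply: contraNN vK => uv.
  rewrite nC in uv; case/setUP: uK => uK.
    by apply/setUP; right; apply: XY uv.
  by apply/setUP; left; apply: YX uv.
(* Rounding up each part separately loses nothing, as [uphalf] is subadditive. *)
move=> B [w [BS mB wP wI]]; exists B, w; split=> //; apply: leq_trans mB.
by rewrite -setDE cardS; clear; lia.
Qed.

Theorem theorem4p3 (G : sgraph) (n : nat) (card_G : #|G| = n)
    (alpha_G : alpha G <= 2)
    (house_free : ~ contains_induced G one_wall_house) :
  contains_immersion G (complete_graph (uphalf n)).
Proof.
have tf := nonadj_triangle_free alpha_G.
apply: immersion_of_linkable; rewrite -card_G -cardsT.
exact: linkable_half tf (nonadj_banner_free tf house_free).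
Qed.
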